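(* Let $p\ge5$ be a prime, let $K\in\mathbb{F}_p$ with $K\neq\pm2$, and put $C=K^2+2K$, $D=-(2K^3+3K^2)$. The Vieta graph of the cubic $x^2+y^2+z^2=xyz-C(x+y+z)+D$ over $\mathbb{F}_p$ satisfies the following. (a) If $K=0$: there are $p^2+1+3\sigma(-1)p$ vertices in total, of which $3p-11-3\sigma(-1)$ are deficient; there are $3\big(p-4-\sigma(-1)\big)$ vertices of degree $2$, $0$ of degree $1$, and $1$ of degree $0$. (b) If $K=-1$: there are $p^2+1+2\sigma(-3)p$ vertices in total, of which $3p-11$ are deficient; there are $3(p-4)$ vertices of degree $2$, $0$ of degree $1$, and $1$ of degree $0$. (c) If $K\neq 0,-1,\pm2$: there are $p^2+1+3\sigma(K^2-4)p$ vertices in total, of which $3p-14-3\sigma(-K-1)$ are deficient; there are $3\big(p-6-\sigma(-K-1)\big)$ vertices of degree $2$, $3$ of degree $1$, and $1$ of degree $0$.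
   Context: $\sigma:\mathbb{F}_p\to\{-1,0,1\}\subset\mathbb{Z}$ denotes the quadratic character: $\sigma(a)=1$ if $a$ is a nonzero square, $\sigma(a)=-1$ if $a$ is a non-square, $\sigma(0)=0$. The Vieta graph of the equation $x^2+y^2+z^2=xyz-C(x+y+z)+D$ over $\mathbb{F}_p$ is the finite simple graph whose vertices are the solutions $(x,y,z)\in\mathbb{F}_p^3$, where two distinct vertices are joined by an edge whenever one is a Vieta flip of the other. The Vieta flips of $(x,y,z)$ are $(yz-C-x,y,z)$, $(x,xz-C-y,z)$, $(x,y,xy-C-z)$. Every vertex has degree at most $3$; a vertex is deficient if its degree is less than $3$. *)

(* Defs.v *)
From HB Require Import structures.
From mathcomp Require Import all_boot all_order all_algebra.

Set Implicit Arguments.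
Unset Strict Implicit.
Unset Printing Implicit Defensive.

Import GRing.Theory.
Local Open Scope ring_scope.

Section VietaGraph.

Variable F : finFieldType.
Implicit Types (a C D : F) (v w : F * F * F).

Definition quadchar a : int :=
  if a == 0 then 0 else if [exists b : F, b ^+ 2 == a] then 1 else -1.

Definition vieta_vertices C D : {set F * F * F} :=
  [set v | let: (x, y, z) := v in
     x ^+ 2 + y ^+ 2 + z ^+ 2 == x * y * z - C * (x + y + z) + D].

Definition vieta_flips C v : seq (F * F * F) :=
  let: (x, y, z) := v in
  [:: (y * z - C - x, y, z); (x, x * z - C - y, z); (x, y, x * y - C - z)].

(* The Vieta graph is encoded as a relation on all of F^3 that is empty
   outside the solution set. *)
Definition vieta_edge C D : rel (F * F * F) := fun v w =>
  [&& v \in vieta_vertices C D, w \in vieta_vertices C D, v != w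
    & (w \in vieta_flips C v) || (v \in vieta_flips C w)].

Definition vieta_degree C D v : nat := #|[set w | vieta_edge C D v w]|.

Definition vieta_deficient C D : {set F * F * F} :=
  [set v in vieta_vertices C D | (vieta_degree C D v < 3)%N].

Definition vieta_of_degree C D (d : nat) : {set F * F * F} :=
  [set v in vieta_vertices C D | vieta_degree C D v == d].

Lemma vieta_edge_sym C D : symmetric (vieta_edge C D).
Proof.
by move=> v w; rewrite /vieta_edge andbCA eq_sym orbC.
Qed.

Lemma vieta_edge_irr C D : irreflexive (vieta_edge C D).
Proof. by move=> v; rewrite /vieta_edge eqxx !andbF. Qed.

End VietaGraph.

(* Main.v *)
Require Import Defs.
From mathcomp Require Import all_boot all_order all_algebra.
From mathcomp Require Import ring zify.

(** Read the cubic as a quadratic in x with discriminant Delta(y, z): the number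
    of solutions is the sum of 1 + sigma(Delta), and the flip in x fixes a
    solution exactly when Delta = 0.  As a quadratic in z, Delta has discriminant
    16 (y + 2) (y + K)^2 (y + K^2 - 2), so both counts reduce to the classical sum
    of sigma over the values of a quadratic polynomial.  The degree of a vertex is
    3 minus the number of flips fixing it.  Two flips fix only (-K, -K, -K) and,
    when K <> 0, a permutation of (w, w, 2 - K^2) with w = -(K + 2)/K; these
    coincide exactly when K = -1.  Inclusion-exclusion gives the degree counts. *)

Set Implicit Arguments.
Unset Strict Implicit.
Unset Printing Implicit Defensive.

Import GRing.Theory Num.Theory.
Local Open Scope ring_scope.

(** * Cardinalities as integer sums of indicator functions *)

Section Counting.

Variable T : finType.
Implicit Type P : pred T.

Lemma card_setE P : (#|[set x | P x]|)%:Z = \sum_x (P x)%:R.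
Proof.
rewrite cardsE -sum1_card big_mkcond /= -natz raddf_sum /=.
by apply: eq_bigr => x _; rewrite unfold_in; case: (P x).
Qed.

Lemma sum_pred_eq (a : T) P : P =1 pred1 a -> \sum_x (P x)%:R = 1 :> int.
Proof.
move=> Pa; rewrite (bigD1 a) //= Pa /= eqxx big1 ?addr0 // => x /negPf xa.
by rewrite Pa /= xa.
Qed.

Lemma sum_eq1 (a : T) : \sum_x (x == a)%:R = 1 :> int.
Proof. exact: (@sum_pred_eq a). Qed.

Lemma sum_pred0 P : P =1 xpred0 -> \sum_x (P x)%:R = 0 :> int.
Proof. by move=> P0; rewrite big1 // => x _; rewrite P0. Qed.

Lemma sum_pred_eq2 (a b : T) P : a != b -> P =1 pred2 a b ->
  \sum_x (P x)%:R = 2 :> int.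
Proof.
move=> ab Pab; rewrite (bigD1 a) //= (bigD1 b) 1?eq_sym //= !Pab /=.
rewrite !eqxx orbT big1 ?addr0 // => x /andP[/negPf xa /negPf xb].
by rewrite Pab /= xa xb.
Qed.

End Counting.

(** * The quadratic character in odd characteristic and its sums over polynomials of degree at most
    2 *)

Section QuadraticCharacter.

Variable F : finFieldType.
Hypothesis two_neq0 : 2 != 0 :> F.
Local Notation sigma := (@quadchar F).
Local Notation q := (#|F|%:Z).
Implicit Types a b c d x y z : F.

Lemma four_neq0 : 4 != 0 :> F.
Proof. by rewrite -[4]/(2 * 2)%:R natrM mulf_neq0. Qed.

Lemma sum_const_card (k : int) : \sum_(x : F) k = q * k.
Proof. by rewrite sumr_const -mulr_natl natz. Qed.

Lemma sum_neq0_1 : \sum_(x : F | x != 0) 1 = q - 1.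
Proof.
by apply: (addrI 1); rewrite subrKC -[q]mulr1 -sum_const_card [RHS](bigD1 0).
Qed.

Lemma quadchar0 : sigma 0 = 0.
Proof. by rewrite /quadchar eqxx. Qed.

Lemma quadchar_sqr b : b != 0 -> sigma (b ^+ 2) = 1.
Proof.
move=> b0; rewrite /quadchar expf_eq0 /= (negPf b0).
by case: existsP => // -[]; exists b.
Qed.

Variant quadchar_spec a : int -> Prop :=
| QuadcharZero of a = 0 : quadchar_spec a 0
| QuadcharSquare b of b != 0 & a = b ^+ 2 : quadchar_spec a 1
| QuadcharNonsquare of a != 0 & (forall b, b ^+ 2 != a) : quadchar_spec a (-1).

Lemma quadcharP a : quadchar_spec a (sigma a).
Proof.
rewrite /quadchar; case: eqVneq => [a0|a0]; first by constructor.
case: (pickP (fun b => b ^+ 2 == a)) => [b /eqP ba | nob].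
  case: existsP => [_|[]]; last by exists b; apply/eqP.
  by apply: (@QuadcharSquare _ b); rewrite // -ba expf_eq0 /= in a0.
case: existsP => [[b]|_]; first by rewrite nob.
by constructor=> // b; rewrite nob.
Qed.

Lemma sum_sqr_eq a : \sum_(x : F) (x ^+ 2 == a)%:R = 1 + sigma a.
Proof.
case: quadcharP => [->|b b0 ->|a0 nob].
- by apply: (@sum_pred_eq _ 0) => x /=; rewrite expf_eq0.
- apply: (@sum_pred_eq2 _ b (- b)) => [|x]; last by rewrite eqf_sqr.
  by rewrite -subr_eq0 opprK -mulr2n -mulr_natl mulf_neq0.
- by apply: sum_pred0 => x; apply/negbTE.
Qed.

(** Double counting of the pairs [(x, x ^+ 2)]: each [x] has one square, and each [a] has
    [1 + sigma a] square roots. *)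
Lemma sum_quadchar : \sum_x sigma x = 0.
Proof.
have: \sum_a \sum_(x : F) (x ^+ 2 == a)%:R = q :> int.
  rewrite exchange_big /= -[RHS]mulr1 -sum_const_card; apply: eq_bigr => x _.
  by apply: (@sum_pred_eq _ (x ^+ 2)) => a /=; rewrite eq_sym.
under eq_bigr do rewrite sum_sqr_eq.
by rewrite big_split /= sum_const_card mulr1 -[RHS]addr0 => /addrI.
Qed.

Lemma sum_affine (f : F -> int) b c : b != 0 -> \sum_x f (b * x + c) = \sum_x f x.
Proof.
move=> b0; rewrite [RHS](reindex (fun x => b * x + c)) //=.
by exists (fun x => (x - c) / b) => x _; field.
Qed.

Lemma quadchar_sqrM b a : b != 0 -> sigma (b ^+ 2 * a) = sigma a.
Proof.
move=> b0; case: (quadcharP a) => [->|c c0 ->|a0 nob].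
- by rewrite mulr0 quadchar0.
- by rewrite -exprMn quadchar_sqr // mulf_neq0.
case: quadcharP => // [/eqP|c c0 /(congr1 (fun t => t / b ^+ 2)) e].
  by rewrite mulf_eq0 expf_eq0 /= (negPf b0) (negPf a0).
case/eqP: (nob (c / b)).
by rewrite expr_div_n -e; field.
Qed.

(* If n is a nonsquare, every term of sum_x (sigma (n x) + sigma x) = 0 is
   nonpositive, so every term vanishes. *)
Lemma quadchar_nonsquareM a b : sigma a = -1 -> sigma (a * b) = - sigma b.
Proof.
move=> sa; have a0 : a != 0 by apply/eqP => a0; rewrite a0 quadchar0 in sa.
have term_le0 x : sigma (a * x) + sigma x <= 0.
  case: (quadcharP x) => [->|c c0 ->|x0 nob]; first by rewrite mulr0 quadchar0.
    by rewrite mulrC quadchar_sqrM // sa.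
  by case: quadcharP.
have /eqP: \sum_x - (sigma (a * x) + sigma x) = 0.
  rewrite sumrN big_split /= sum_quadchar addr0.
  suff -> : \sum_x sigma (a * x) = 0 by rewrite oppr0.
  apply: etrans sum_quadchar; rewrite -[RHS](sum_affine sigma 0 a0).
  by apply: eq_bigr => x _; rewrite addr0.
rewrite psumr_eq0 => [|x _]; last by rewrite oppr_ge0.
move=> /allP /(_ b); rewrite mem_index_enum oppr_eq0 => /(_ isT) /eqP.
by lia.
Qed.

Lemma quadcharM a b : sigma (a * b) = sigma a * sigma b.
Proof.
case: (quadcharP a) (@quadchar_nonsquareM a b) => [-> _|c c0 -> _|_ _ ->] //.
- by rewrite mul0r quadchar0 mul0r.
- by rewrite quadchar_sqrM // mul1r.
- by rewrite mulN1r.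
Qed.

(** Completing the square: [4 * a] times the polynomial is [u ^+ 2] minus the discriminant, where
    [u = 2 * a * x + b] runs over the whole field. *)
Lemma sum_quadratic_roots a b c : a != 0 ->
  \sum_(x : F) (a * x ^+ 2 + b * x + c == 0)%:R = 1 + sigma (b ^+ 2 - 4 * a * c).
Proof.
move=> a0; have a20 : 2 * a != 0 by rewrite mulf_neq0.
rewrite -sum_sqr_eq -[RHS](sum_affine _ b a20); apply: eq_bigr => x _.
rewrite -[in RHS]subr_eq0.
have -> : (2 * a * x + b) ^+ 2 - (b ^+ 2 - 4 * a * c) =
  4 * a * (a * x ^+ 2 + b * x + c) by ring.
by rewrite !mulf_eq0 (negPf a0) (negPf four_neq0).
Qed.

(* The conic v^2 = u^2 - d is the hyperbola (u - v)(u + v) = d. *)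
Lemma sum_quadchar_sqrB d :
  \sum_u sigma (u ^+ 2 - d) = if d == 0 then q - 1 else -1.
Proof.
case: (eqVneq d 0) => [->|d0].
  rewrite (bigD1 0) //= subr0 expr0n quadchar0 add0r.
  by rewrite -sum_neq0_1; apply: eq_bigr => u u0; rewrite subr0 quadchar_sqr.
have: \sum_(u : F) \sum_(v : F) (v ^+ 2 == u ^+ 2 - d)%:R = q - 1 :> int.
  transitivity (\sum_(s : F) \sum_(t : F) (s * t == d)%:R : int).
    (* Put [v = u - s], so that [u + v = 2 * u - s]; for fixed [s] this second factor is then the
       free variable [t]. *)
    transitivity (\sum_(u : F) \sum_(s : F) (s * (2 * u - s) == d)%:R : int).
      apply: eq_bigr => u _.
      have m1 : -1 != 0 :> F by rewrite oppr_eq0 oner_eq0.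
      rewrite -[LHS](sum_affine _ u m1); apply: eq_bigr => s _; congr (_%:R).
      congr (nat_of_bool _); rewrite -subr_eq0 -[RHS]subr_eq0 -oppr_eq0.
      by congr (_ == 0); ring.
    rewrite exchange_big /=; apply: eq_bigr => s _.
    by rewrite -[RHS](sum_affine (fun t => (s * t == d)%:R) (- s) two_neq0).
  rewrite (bigD1 0) //= big1 ?add0r => [|t _]; last first.
    by rewrite mul0r eq_sym (negPf d0).
  rewrite -sum_neq0_1; apply: eq_bigr => s s0.
  apply: (@sum_pred_eq _ (d / s)) => t /=.
  by rewrite -[RHS](inj_eq (mulfI s0)) mulrCA mulfV // mulr1.
under eq_bigr do rewrite sum_sqr_eq.
by rewrite big_split /= sum_const_card mulr1 => /addrI.
Qed.

(** Multiplying the polynomial by the square [(2 * a) ^+ 2] gives [a] times [u ^+ 2] minus the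
    discriminant, with [u = 2 * a * x + b]; the conic count then applies. *)
Lemma sum_quadchar_quadratic a b c : a != 0 ->
  \sum_x sigma (a * x ^+ 2 + b * x + c) =
  sigma a * (if b ^+ 2 - 4 * a * c == 0 then q - 1 else -1).
Proof.
move=> a0; have a20 : 2 * a != 0 by rewrite mulf_neq0.
rewrite -sum_quadchar_sqrB -(sum_affine (fun u => sigma (u ^+ 2 - _)) b a20) mulr_sumr.
apply: eq_bigr => x _; rewrite -quadcharM.
have -> : a * ((2 * a * x + b) ^+ 2 - (b ^+ 2 - 4 * a * c)) =
  (2 * a) ^+ 2 * (a * x ^+ 2 + b * x + c) by ring.
by rewrite quadchar_sqrM.
Qed.

Lemma sum_quadchar_affine b c : b != 0 -> \sum_x sigma (b * x + c) = 0.
Proof. by move=> b0; rewrite sum_affine // sum_quadchar. Qed.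

End QuadraticCharacter.

(** * Counting triples, with invariance under permuting the coordinates *)

Section Triples.

Variable T : finType.
Implicit Type P Q : T -> T -> T -> bool.

Definition card3 P : int := \sum_(v : T * T * T) (P v.1.1 v.1.2 v.2)%:R.

Lemma card3E P : card3 P = \sum_x \sum_y \sum_z (P x y z)%:R.
Proof. by rewrite pair_bigA pair_bigA. Qed.

Lemma eq_card3 P Q : (forall x y z, P x y z = Q x y z) -> card3 P = card3 Q.
Proof. by move=> PQ; apply: eq_bigr => v _; rewrite PQ. Qed.

Lemma card3_swap12 P : card3 P = card3 (fun x y z => P y x z).
Proof. by rewrite !card3E exchange_big. Qed.

Lemma card3_swap23 P : card3 P = card3 (fun x y z => P x z y).
Proof. by rewrite !card3E; apply: eq_bigr => x _; rewrite exchange_big. Qed.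

Lemma card3_eq P a : (forall x y z, P x y z = ((x, y, z) == a)) -> card3 P = 1.
Proof. by move=> Pa; apply: (@sum_pred_eq _ a) => -[[x y] z] /=. Qed.

Lemma card3_eq2 P a b : a != b ->
  (forall x y z, P x y z = ((x, y, z) == a) || ((x, y, z) == b)) -> card3 P = 2.
Proof. by move=> ab Pab; apply: (sum_pred_eq2 ab) => -[[x y] z] /=. Qed.

End Triples.

(** * The cubic, its discriminant, and the number of vertices *)

Section VietaCount.

Variable F : finFieldType.
Hypothesis two_neq0 : 2 != 0 :> F.
Local Notation sigma := (@quadchar F).
Local Notation q := (#|F|%:Z).
Variable K : F.
Hypothesis K_neq2 : K != 2.
Hypothesis K_neqN2 : K != - 2.
Let C : F := K ^+ 2 + 2 * K.
Let D : F := - (2 * K ^+ 3 + 3 * K ^+ 2).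
Implicit Types x y z : F.

Definition is_solution x y z : bool :=
  x ^+ 2 + y ^+ 2 + z ^+ 2 == x * y * z - C * (x + y + z) + D.

(* The first argument is the flipped coordinate: since the cubic is symmetric,
   the flips in y and z are flip_fixed y x z and flip_fixed z x y. *)
Definition flip_fixed x y z : bool := y * z - C - x == x.

Definition flip_disc y z : F :=
  (y * z - C) ^+ 2 - 4 * (y ^+ 2 + z ^+ 2 + C * (y + z) - D).

Lemma is_solution_swap12 x y z : is_solution x y z = is_solution y x z.
Proof.
by rewrite /is_solution -subr_eq0 -[RHS]subr_eq0; congr (_ == 0); ring.
Qed.

Lemma is_solution_swap23 x y z : is_solution x y z = is_solution x z y.
Proof.
by rewrite /is_solution -subr_eq0 -[RHS]subr_eq0; congr (_ == 0); ring.
Qed.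

Lemma flip_fixed_swap x y z : flip_fixed x y z = flip_fixed x z y.
Proof. by rewrite /flip_fixed (mulrC y). Qed.

Lemma KB2_neq0 : K - 2 != 0. Proof. by rewrite subr_eq0. Qed.
Lemma KD2_neq0 : K + 2 != 0. Proof. by rewrite addr_eq0. Qed.

Lemma sum_is_solution y z : \sum_x (is_solution x y z)%:R = 1 + sigma (flip_disc y z).
Proof.
have -> : flip_disc y z = (- (y * z - C)) ^+ 2 -
    4 * 1 * (y ^+ 2 + z ^+ 2 + C * (y + z) - D) by rewrite /flip_disc; ring.
rewrite -sum_quadratic_roots ?oner_eq0 //; apply: eq_bigr => x _.
congr (nat_of_bool _)%:R.
by rewrite /is_solution -subr_eq0; congr (_ == 0); ring.
Qed.

(** A fixed [x] must be the midpoint [(y * z - C) / 2] of the two roots, and the midpoint is a root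
    exactly when the roots coincide. *)
Lemma sum_solution_fixed y z :
  \sum_x (is_solution x y z && flip_fixed x y z)%:R = (flip_disc y z == 0%R)%:R :> int.
Proof.
have eqx x : is_solution x y z && flip_fixed x y z =
    (flip_disc y z == 0) && (x == (y * z - C) / 2).
  rewrite andbC [RHS]andbC.
  have -> : flip_fixed x y z = (x == (y * z - C) / 2).
    rewrite /flip_fixed -subr_eq0 -[RHS]subr_eq0.
    have -> : y * z - C - x - x = (- 2) * (x - (y * z - C) / 2) by field.
    by rewrite mulf_eq0 oppr_eq0 (negPf two_neq0).
  case: eqVneq => //= xE.
  rewrite /is_solution -subr_eq0.
  have -> : flip_disc y z = - 4 * (x ^+ 2 + y ^+ 2 + z ^+ 2 -
      (x * y * z - C * (x + y + z) + D)).
    by rewrite xE /flip_disc; field.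
  by rewrite mulf_eq0 oppr_eq0 (negPf (four_neq0 two_neq0)).
case: (flip_disc y z == 0) eqx => eqx; last exact: sum_pred0.
exact: (@sum_pred_eq _ ((y * z - C) / 2)).
Qed.

Lemma flip_discE y z : flip_disc y z =
  (y ^+ 2 - 4) * z ^+ 2 + (- 2 * C * (y + 2)) * z +
  (C ^+ 2 - 4 * y ^+ 2 - 4 * C * y + 4 * D).
Proof. by rewrite /flip_disc; ring. Qed.

(** Here the special form of [C] and [D] enters: it produces the double root [- K], so that up to
    squares only a quadratic in [y] remains. *)
Lemma disc_flip_disc y :
  (- 2 * C * (y + 2)) ^+ 2 -
  4 * (y ^+ 2 - 4) * (C ^+ 2 - 4 * y ^+ 2 - 4 * C * y + 4 * D) =
  (4 * (y + K)) ^+ 2 * ((y + 2) * (y + K ^+ 2 - 2)).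
Proof. rewrite /C /D; ring. Qed.

Lemma flip_discN2 z : flip_disc (- 2) z = (K - 2) ^+ 2 * (K ^+ 2 - 4).
Proof. rewrite /flip_disc /C /D; ring. Qed.

Lemma flip_disc2 z :
  flip_disc 2 z = (- 8 * K * (K + 2)) * z + (C ^+ 2 - 16 - 8 * C + 4 * D).
Proof. rewrite /flip_disc /C /D; ring. Qed.

Lemma eight_neq0 : 8 != 0 :> F.
Proof.
by rewrite (_ : 8 = 2 * 4) ?mulf_neq0 ?four_neq0 // -natrM.
Qed.

Lemma two_neqN2 : 2 != - 2 :> F.
Proof. by rewrite -addr_eq0 -natrD four_neq0. Qed.

(** For [y] other than 2 and -2 this is a genuine quadratic in [z], with an extra multiple of [q]
    when its discriminant vanishes, at [- K] and [2 - K ^+ 2]. At -2 it is constant, and at 2 it is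
    affine, or constant if [K = 0]. The root [2 - K ^+ 2] counts separately only if it differs from
    2 ([K != 0]) and from [- K] ([K != - 1]). *)
Lemma sum_quadchar_flip_disc y :
  \sum_z sigma (flip_disc y z) = - sigma (y ^+ 2 - 4) +
    q * ((y == - 2)%:R * sigma (K ^+ 2 - 4) +
         (y == 2)%:R * ((K == 0)%:R * sigma (- 1)) +
         (y == - K)%:R * sigma (K ^+ 2 - 4) +
         (y == 2 - K ^+ 2)%:R * ((K != 0) && (K != - 1))%:R * sigma (K ^+ 2 - 4)).
Proof.
have NKneq : (- 2 == - K) = false by rewrite eqr_opp eq_sym (negPf K_neq2).
have NKneq' : (2 == - K) = false by rewrite -eqr_oppLR eq_sym (negPf K_neqN2).
have N2neq : (- 2 == 2 - K ^+ 2) = false.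
  apply/negbTE; rewrite -subr_eq0.
  have -> : - 2 - (2 - K ^+ 2) = (K - 2) * (K + 2) by ring.
  by rewrite mulf_neq0 ?KB2_neq0 ?KD2_neq0.
have e2 : (2 == 2 - K ^+ 2) = (K == 0).
  rewrite -subr_eq0 (_ : 2 - (2 - K ^+ 2) = K ^+ 2) ?expf_eq0 //; ring.
case: (eqVneq y (- 2)) => [->|yN2].
  rewrite NKneq N2neq eq_sym (negPf two_neqN2) !mul0r !addr0 mul1r.
  have -> : (- 2) ^+ 2 - 4 = 0 :> F by ring.
  rewrite quadchar0 oppr0 add0r.
  under eq_bigr do rewrite flip_discN2 quadchar_sqrM ?KB2_neq0 //.
  by rewrite sum_const_card.
case: (eqVneq y 2) => [->|y2].
  have -> : 2 ^+ 2 - 4 = 0 :> F by ring.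
  rewrite NKneq' e2 quadchar0 oppr0 !mul0r !add0r !addr0.
  under eq_bigr do rewrite flip_disc2.
  case: (eqVneq K 0) => [K0|K0] /=; last first.
    rewrite sum_quadchar_affine //; first by ring.
    by rewrite !mulf_neq0 // ?KD2_neq0 // oppr_eq0 eight_neq0.
  rewrite !mul1r mul0r addr0 -sum_const_card; apply: eq_bigr => z _.
  (* For [K = 0] the constant value is -16, that is [4 ^+ 2 * -1]. *)
  rewrite -(quadchar_sqrM (-1) (four_neq0 two_neq0)).
  by congr sigma; rewrite /C /D K0; ring.
have y4 : y ^+ 2 - 4 != 0.
  rewrite (_ : y ^+ 2 - 4 = (y - 2) * (y + 2)); last ring.
  by rewrite mulf_neq0 // ?subr_eq0 // addr_eq0.
under eq_bigr do rewrite flip_discE.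
rewrite sum_quadchar_quadratic // disc_flip_disc !mulf_eq0 orbb.
rewrite (negPf (four_neq0 two_neq0)) (addr_eq0 y 2) (addr_eq0 y K) (negPf yN2) /=.
have -> : (y + K ^+ 2 - 2 == 0) = (y == 2 - K ^+ 2) by rewrite -addrA addr_eq0 opprB.
case: (eqVneq y (- K)) => [yK|yK] /=.
  have -> : y ^+ 2 = K ^+ 2 by rewrite yK sqrrN.
  case: (eqVneq y (2 - K ^+ 2)) => [e|_] /=; last by ring.
  suff -> : ((K != 0) && (K != -1)) = false by rewrite /=; ring.
  have : (K - 2) * (K + 1) = 0.
    by rewrite -[RHS](subrr y) {1}yK e; ring.
  by move/eqP; rewrite mulf_eq0 (negPf KB2_neq0) addr_eq0 => /= ->; rewrite andbF.
case: (eqVneq y (2 - K ^+ 2)) => [e|_] /=; last by ring.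
have K0 : K != 0.
  by apply/eqP => K0; rewrite e K0 expr0n subr0 eqxx in y2.
have K1 : K != - 1.
  by apply/eqP => K1; case/eqP: yK; rewrite e K1; ring.
rewrite K0 K1 /=.
have -> : y ^+ 2 - 4 = K ^+ 2 * (K ^+ 2 - 4) by rewrite e; ring.
by rewrite quadchar_sqrM //; ring.
Qed.

Lemma sum_quadchar_sqrB4 : \sum_y sigma (y ^+ 2 - 4) = - 1.
Proof. by rewrite sum_quadchar_sqrB // (negPf (four_neq0 two_neq0)). Qed.

(** Summed over [y], the term [- sigma (y ^+ 2 - 4)] gives the constant 1, and each indicator of a
    special [y] gives its coefficient once. *)
Lemma card_vieta_vertices : (#|vieta_vertices C D|)%:Z =
  q ^+ 2 + 1 + ((2 + ((K != 0) && (K != - 1))%:R) * sigma (K ^+ 2 - 4) +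
                (K == 0)%:R * sigma (- 1)) * q.
Proof.
rewrite card_setE.
transitivity (card3 is_solution); first by apply: eq_bigr => -[[x y] z] _.
rewrite card3E exchange_big /=.
transitivity (\sum_y (q + \sum_z sigma (flip_disc y z))).
  apply: eq_bigr => y _; rewrite exchange_big /=.
  under eq_bigr do rewrite sum_is_solution.
  by rewrite big_split /= sum_const_card mulr1.
under eq_bigr do rewrite sum_quadchar_flip_disc.
rewrite !big_split /= sum_const_card sumrN sum_quadchar_sqrB4 -mulr_sumr.
rewrite !big_split /= -!mulr_suml !sum_eq1.
ring.
Qed.

(** * Solutions fixed by one flip, by two flips, and by all three *)

(** The generic root count drops the square factor [(4 * (y + K)) ^+ 2], which is wrong only at
    [y = - K], where the character is 0 instead of [sigma (- K - 1)]. At 2 and -2 the polynomial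
    loses its degree and has one root fewer than the formula predicts. *)
Lemma sum_flip_disc_eq0 y : \sum_z (flip_disc y z == 0)%:R =
  1 + sigma ((y + 2) * (y + K ^+ 2 - 2)) -
  ((y == - K)%:R * sigma (- K - 1) + (y == - 2)%:R + (y == 2)%:R).
Proof.
have NKneq : (- 2 == - K) = false by rewrite eqr_opp eq_sym (negPf K_neq2).
have NKneq' : (2 == - K) = false by rewrite -eqr_oppLR eq_sym (negPf K_neqN2).
case: (eqVneq y (- 2)) => [->|yN2].
  rewrite NKneq [- 2 == 2]eq_sym (negPf two_neqN2) addNr !mul0r quadchar0.
  rewrite sum_pred0 => [|z]; first by rewrite /=; ring.
  rewrite flip_discN2 (_ : K ^+ 2 - 4 = (K - 2) * (K + 2)); last ring.
  by apply/negbTE; rewrite !mulf_neq0 ?expf_neq0 ?KB2_neq0 ?KD2_neq0.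
case: (eqVneq y 2) => [->|y2].
  have -> : (2 + 2) * (2 + K ^+ 2 - 2) = 2 ^+ 2 * K ^+ 2 by ring.
  rewrite quadchar_sqrM // NKneq' mul0r.
  case: (eqVneq K 0) => [K0|K0].
    rewrite sum_pred0 => [|z].
      by rewrite K0 expr0n quadchar0 /=; ring.
    rewrite flip_disc2 /C /D K0; apply/negbTE.
    have -> : - 8 * 0 * (0 + 2) * z + ((0 ^+ 2 + 2 * 0) ^+ 2 - 16 -
      8 * (0 ^+ 2 + 2 * 0) + 4 * - (2 * 0 ^+ 3 + 3 * 0 ^+ 2)) = - (4 * 4) by ring.
    by rewrite oppr_eq0 mulf_neq0 ?four_neq0.
  rewrite quadchar_sqr //.
  set b := - 8 * K * (K + 2).
  have b0 : b != 0 by rewrite !mulf_neq0 ?KD2_neq0 // oppr_eq0 eight_neq0.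
  rewrite (@sum_pred_eq _ (- (C ^+ 2 - 16 - 8 * C + 4 * D) / b)) => [|z].
    by rewrite /=; ring.
  rewrite flip_disc2 -/b /= addr_eq0 -[RHS](inj_eq (mulfI b0)).
  by rewrite mulrCA mulfV // mulr1.
have y4 : y ^+ 2 - 4 != 0.
  rewrite (_ : y ^+ 2 - 4 = (y - 2) * (y + 2)); last ring.
  by rewrite mulf_neq0 // ?subr_eq0 // addr_eq0.
under eq_bigr do rewrite flip_discE.
rewrite sum_quadratic_roots // disc_flip_disc.
case: (eqVneq y (- K)) => [->|yK].
  rewrite addNr mulr0 expr0n mul0r quadchar0.
  have -> : (- K + 2) * (- K + K ^+ 2 - 2) = (K - 2) ^+ 2 * (- K - 1) by ring.
  by rewrite quadchar_sqrM ?KB2_neq0 //=; ring.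
rewrite quadchar_sqrM //=; first by ring.
by rewrite mulf_neq0 ?four_neq0 // addr_eq0.
Qed.

Lemma card3_fixed1 :
  card3 (fun x y z => is_solution x y z && flip_fixed x y z) = q - 3 - sigma (- K - 1).
Proof.
rewrite card3E exchange_big /=.
transitivity (\sum_y \sum_z (flip_disc y z == 0%R)%:R : int).
  apply: eq_bigr => y _; rewrite exchange_big /=.
  by apply: eq_bigr => z _; rewrite sum_solution_fixed.
under eq_bigr do rewrite sum_flip_disc_eq0.
rewrite big_split /= sumrN !big_split /= sum_const_card -mulr_suml.
rewrite !sum_eq1.
(* This monic quadratic has roots -2 and [2 - K ^+ 2], distinct because [K ^+ 2] is not 4. *)
have -> : \sum_y sigma ((y + 2) * (y + K ^+ 2 - 2)) = - 1; last by ring.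
have e y : (y + 2) * (y + K ^+ 2 - 2) = 1 * y ^+ 2 + K ^+ 2 * y + (2 * K ^+ 2 - 4) by ring.
under eq_bigr do rewrite e.
rewrite sum_quadchar_quadratic ?oner_eq0 //.
have -> : (K ^+ 2) ^+ 2 - 4 * 1 * (2 * K ^+ 2 - 4) = ((K - 2) * (K + 2)) ^+ 2 by ring.
rewrite expf_eq0 /= mulf_eq0 (negPf KB2_neq0) (negPf KD2_neq0) /=.
by rewrite -[1](expr1n _ 2) quadchar_sqr ?oner_eq0 // mul1r.
Qed.

(** Subtracting the two fixing equations gives [(x - y) * (z + 2) = 0], hence [x = y]. Then
    [x * z = 2 * x + C] eliminates [z] from the cubic. *)
Lemma fixed12P x y z :
  is_solution x y z && flip_fixed x y z && flip_fixed y x z =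
  ((x, y, z) == (- K, - K, - K)) ||
  (K != 0) && ((x, y, z) == (- (K + 2) / K, - (K + 2) / K, 2 - K ^+ 2)).
Proof.
apply/idP/idP => [/andP[/andP[/eqP sol /eqP f1] /eqP f2]|]; last first.
  case/predU1P => [[-> -> ->]|/andP[K0 /eqP[-> -> ->]]].
    rewrite /is_solution /flip_fixed /C /D.
    by rewrite -!andbA; apply/and3P; split; apply/eqP; ring.
  rewrite /is_solution /flip_fixed /C /D.
  by rewrite -!andbA; apply/and3P; split; apply/eqP; field.
have zN2 : z + 2 != 0.
  rewrite addr_eq0; apply/eqP => zE.
  (* The left side is the discriminant in [x] at [z = - 2], a nonzero constant, whereas a fixed
     solution makes the discriminant vanish. *)
  have : (K - 2) ^+ 2 * ((K - 2) * (K + 2)) = 0.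
    have -> : (K - 2) ^+ 2 * ((K - 2) * (K + 2)) =
        (y * z - C - x - x) ^+ 2 - 4 * (x ^+ 2 + y ^+ 2 + z ^+ 2 -
           (x * y * z - C * (x + y + z) + D)).
      by rewrite zE /C /D; ring.
    by rewrite f1 subrr sol subrr expr0n mulr0 subrr.
  by apply/eqP; rewrite !mulf_neq0 ?expf_neq0 ?KB2_neq0 ?KD2_neq0.
have /eqP : (x - y) * (z + 2) = 0.
  have -> : (x - y) * (z + 2) =
    (x * z - C - y - y) - (y * z - C - x - x) by ring.
  by rewrite f1 f2 !subrr.
rewrite mulf_eq0 (negPf zN2) orbF subr_eq0 => /eqP xy; subst y.
have {f1 f2} xz : x * z = 2 * x + C.
  by transitivity (x * z - C - x + C + x); [ring | rewrite f1; ring].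
(* The root [x = - K] determines [z] only after cancelling [K] in [x * z = 2 * x + C], so [K = 0] is
   treated apart. *)
have [K0|K0] /= := eqVneq K 0.
  have C0 : C = 0 by rewrite /C K0; ring.
  have D0 : D = 0 by rewrite /D K0; ring.
  rewrite C0 addr0 in xz.
  have /eqP : z ^+ 2 = 0.
    have -> : z ^+ 2 = (x ^+ 2 + x ^+ 2 + z ^+ 2) - x * (2 * x) by ring.
    by rewrite sol -xz C0 D0; ring.
  rewrite expf_eq0 /= => /eqP z0.
  have /eqP : 2 * x = 0 by rewrite -xz z0 mulr0.
  by rewrite mulf_eq0 (negPf two_neq0) /= z0 K0 oppr0 => /eqP ->; rewrite eqxx.
(* This is [x ^+ 2] times the cubic after replacing [x * z] by [2 * x + C]; the subtracted product
   accounts for the replacement. *)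
have : (K + 2) * (x + K) ^+ 2 * (K * x + (K + 2)) = 0.
  have -> : (K + 2) * (x + K) ^+ 2 * (K * x + (K + 2)) =
    x ^+ 2 * (x ^+ 2 + x ^+ 2 + z ^+ 2 - (x * x * z - C * (x + x + z) + D)) -
    (x * z - (2 * x + C)) * (x * z + 2 * x + C - x ^+ 3 + C * x).
    by rewrite /C /D; ring.
  by rewrite sol xz !subrr mulr0 mul0r subrr.
move/eqP; rewrite !mulf_eq0 (negPf KD2_neq0) orbb /= => /orP[|].
  rewrite addr_eq0 => /eqP xK; apply/orP; left.
  suff -> : z = - K by rewrite xK.
  by apply: (mulfI K0); rewrite -[LHS]opprK -mulNr -xK xz xK /C; ring.
rewrite addr_eq0 => /eqP Kx; apply/orP; right.
have xE : x = - (K + 2) / K by rewrite -Kx mulrC mulKf.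
suff -> : z = 2 - K ^+ 2 by rewrite -xE.
apply: (mulfI KD2_neq0); apply: oppr_inj; rewrite -mulNr -Kx -mulrA xz.
by rewrite mulrDr mulrCA Kx /C; ring.
Qed.

(** At the second point, the third fixing equation times [K ^+ 2] reads
    [(K - 2) ^+ 2 * (K + 1) ^+ 2 = 0]. This forces [K = - 1], where both points coincide. *)
Lemma fixed123P x y z :
  is_solution x y z && flip_fixed x y z && flip_fixed y x z && flip_fixed z x y =
  ((x, y, z) == (- K, - K, - K)).
Proof.
rewrite fixed12P; apply/andP/eqP => [[]|[-> -> ->]]; last first.
  by rewrite eqxx /flip_fixed; split=> //; apply/eqP; rewrite /C; ring.
case/predU1P => // /andP[K0 /eqP[-> -> ->]].
set w := - (K + 2) / K => /eqP f3.
have /eqP : (K - 2) ^+ 2 * (K + 1) ^+ 2 = 0.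
  transitivity (K ^+ 2 * (w * w - C - (2 - K ^+ 2) - (2 - K ^+ 2))).
    by rewrite /w /C; field.
  by rewrite f3 subrr mulr0.
rewrite !mulf_eq0 (negPf KB2_neq0) /= orbb addr_eq0.
move=> /eqP K1; have -> : w = - K by rewrite /w K1 invrN1; ring.
by congr (_, _, _); rewrite K1; ring.
Qed.

(** * Vertex degrees and their distribution *)

Lemma vieta_flips_sym (v w : F * F * F) : v \in vieta_flips C w -> w \in vieta_flips C v.
Proof.
case: v w => [[x y] z] [[x' y'] z']; rewrite !inE.
by case/or3P => /eqP[-> -> ->]; rewrite !subKr eqxx ?orbT.
Qed.

Lemma vieta_flips_solution (v w : F * F * F) :
  v \in vieta_vertices C D -> w \in vieta_flips C v -> w \in vieta_vertices C D.
Proof.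
case: v w => [[x y] z] [[x' y'] z']; rewrite !inE -subr_eq0 => /eqP sol.
by case/or3P => /eqP[-> -> ->]; rewrite -subr_eq0; apply/eqP; apply: etrans sol; ring.
Qed.

(** Flips are involutions preserving the solution set, so the neighbours are the flips that move the
    vertex; these are pairwise distinct since they change different coordinates. *)
Lemma vieta_degreeE x y z : is_solution x y z ->
  vieta_degree C D (x, y, z) =
  (~~ flip_fixed x y z + ~~ flip_fixed y x z + ~~ flip_fixed z x y)%N.
Proof.
move=> sol; have v_sol : (x, y, z) \in vieta_vertices C D by rewrite inE.
pose s := [seq w <- vieta_flips C (x, y, z) | (x, y, z) != w].
have -> : vieta_degree C D (x, y, z) = #|s|.
  rewrite /vieta_degree cardsE; apply: eq_card => w.
  rewrite mem_filter unfold_in /vieta_edge v_sol /= andbCA; congr (_ && _).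
  apply/andP/idP => [[_ /orP[//|/vieta_flips_sym //]]|wv].
  by rewrite wv (vieta_flips_solution v_sol wv).
have size_s : size s =
    (~~ flip_fixed x y z + ~~ flip_fixed y x z + ~~ flip_fixed z x y)%N.
  rewrite size_filter /= !xpair_eqE !eqxx /= !andbT addn0 addnA /flip_fixed.
  by rewrite ![_ == _ - _]eq_sym.
rewrite -size_s; apply/card_uniqP.
rewrite /s /= !xpair_eqE !eqxx /= !andbT.
case: eqVneq => xx; case: eqVneq => yy; case: eqVneq => zz //=;
  by rewrite !inE !xpair_eqE ?eqxx ?(negPf xx) ?(negPf yy) ?(negPf zz) ?andbF //=
    eq_sym ?(negPf xx) ?(negPf yy) ?andbF.
Qed.

Lemma card3_fixed2 :
  card3 (fun x y z => is_solution x y z && flip_fixed y x z) = q - 3 - sigma (- K - 1).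
Proof.
rewrite -card3_fixed1 card3_swap12; apply: eq_card3 => x y z.
by rewrite is_solution_swap12.
Qed.

Lemma card3_fixed3 :
  card3 (fun x y z => is_solution x y z && flip_fixed z x y) = q - 3 - sigma (- K - 1).
Proof.
rewrite -card3_fixed2 card3_swap23; apply: eq_card3 => x y z.
by rewrite is_solution_swap23.
Qed.

Lemma card3_fixed12 :
  card3 (fun x y z => is_solution x y z && flip_fixed x y z && flip_fixed y x z) =
  1 + ((K != 0) && (K != - 1))%:R.
Proof.
case: (eqVneq K 0) => [K0|K0] /=.
  rewrite (@card3_eq _ _ (- K, - K, - K)) // => x y z.
  by rewrite fixed12P K0 eqxx orbF.
case: (eqVneq K (- 1)) => [K1|K1] /=.
  rewrite (@card3_eq _ _ (- K, - K, - K)) // => x y z.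
  rewrite fixed12P K0 /=.
  have -> : - (K + 2) / K = - K by rewrite K1 invrN1; ring.
  have -> : 2 - K ^+ 2 = - K by rewrite K1; ring.
  by rewrite orbb.
rewrite (@card3_eq2 _ _ (- K, - K, - K) (- (K + 2) / K, - (K + 2) / K, 2 - K ^+ 2)) //.
  apply/eqP => -[_ _ e].
  have /eqP : (K - 2) * (K + 1) = 0.
    by transitivity (- K - (2 - K ^+ 2)); [ring | rewrite -e subrr].
  by rewrite mulf_eq0 (negPf KB2_neq0) addr_eq0 (negPf K1).
by move=> x y z; rewrite fixed12P K0.
Qed.

Lemma card3_fixed13 :
  card3 (fun x y z => is_solution x y z && flip_fixed x y z && flip_fixed z x y) =
  1 + ((K != 0) && (K != - 1))%:R.
Proof.
rewrite -card3_fixed12 card3_swap23; apply: eq_card3 => x y z.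
by rewrite is_solution_swap23 (flip_fixed_swap x).
Qed.

Lemma card3_fixed23 :
  card3 (fun x y z => is_solution x y z && flip_fixed y x z && flip_fixed z x y) =
  1 + ((K != 0) && (K != - 1))%:R.
Proof.
rewrite -card3_fixed13 card3_swap12; apply: eq_card3 => x y z.
by rewrite is_solution_swap12 (flip_fixed_swap z).
Qed.

Lemma card3_fixed123 :
  card3 (fun x y z => is_solution x y z && flip_fixed x y z && flip_fixed y x z &&
    flip_fixed z x y) = 1.
Proof. exact: card3_eq fixed123P. Qed.

(* Inclusion-exclusion on the number of fixed flips: s1, s2, s3 count the
   solutions weighted by the number of sets of 1, 2, 3 fixed flips. *)
Lemma card_vieta_degree (P : pred nat) : ~~ P 3 ->
  let s1 := 3 * (q - 3 - sigma (- K - 1)) in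
  let s2 := 3 * (1 + ((K != 0) && (K != - 1))%:R) in
  let s3 := 1 in
  (#|[set v in vieta_vertices C D | P (vieta_degree C D v)]|)%:Z =
  (P 2)%:R * (s1 - 2 * s2 + 3 * s3) + (P 1)%:R * (s2 - 3 * s3) + (P 0)%:R * s3.
Proof.
move=> /negbTE P3 s1 s2 s3.
(* The coefficients solve [k1 * j + k2 * binomial(j, 2) + k3 * binomial(j, 3) = P (3 - j)] for [j] =
   0, 1, 2, 3 fixed flips; the case [j = 0] is [~~ P 3]. *)
pose k1 : int := (P 2)%:R; pose k2 : int := (P 1)%:R - 2 * (P 2)%:R.
pose k3 : int := 3 * (P 2)%:R - 3 * (P 1)%:R + (P 0)%:R.
transitivity (k1 * s1 + k2 * s2 + k3 * s3); last by rewrite /k1 /k2 /k3; ring.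
have -> : s1 = (q - 3 - sigma (- K - 1)) + (q - 3 - sigma (- K - 1)) +
  (q - 3 - sigma (- K - 1)) by rewrite /s1; ring.
have -> : s2 = (1 + ((K != 0) && (K != - 1))%:R) +
  (1 + ((K != 0) && (K != - 1))%:R) + (1 + ((K != 0) && (K != - 1))%:R).
  by rewrite /s2; ring.
rewrite -{1}card3_fixed1 -{1}card3_fixed2 -{1}card3_fixed3.
rewrite -{1}card3_fixed12 -{1}card3_fixed13 -{1}card3_fixed23 /s3 -card3_fixed123.
rewrite card_setE /card3 -!big_split !mulr_sumr -!big_split /=.
apply: eq_bigr => -[[x y] z] _ /=.
have -> : ((x, y, z) \in vieta_vertices C D) = is_solution x y z by rewrite inE.
have [sol|_] /= := boolP (is_solution x y z); last by ring.
rewrite vieta_degreeE // /k1 /k2 /k3.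
by case: flip_fixed; case: flip_fixed; case: flip_fixed;
  rewrite /= ?(addn0, add0n, addn1) ?P3 /=; ring.
Qed.

End VietaCount.

(** * Specialisation to the prime field and the three cases of [K] *)

Theorem theorem11p4 (p : nat) (p_prime : prime p) (p_ge5 : (5 <= p)%N)
    (K : 'F_p) (K_neq2 : K <> 2) (K_neqN2 : K <> -2) :
  let C : 'F_p := K ^+ 2 + 2 * K in
  let D : 'F_p := - (2 * K ^+ 3 + 3 * K ^+ 2) in
  let sigma : 'F_p -> int := @quadchar 'F_p in
  [/\ K = 0 ->
      [/\ (#|vieta_vertices C D|)%:Z = p%:Z ^+ 2 + 1 + 3 * sigma (-1) * p%:Z,
          (#|vieta_deficient C D|)%:Z = 3 * p%:Z - 11 - 3 * sigma (-1),
          (#|vieta_of_degree C D 2|)%:Z = 3 * (p%:Z - 4 - sigma (-1)),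
          #|vieta_of_degree C D 1| = 0%N
        & #|vieta_of_degree C D 0| = 1%N],
      K = -1 ->
      [/\ (#|vieta_vertices C D|)%:Z = p%:Z ^+ 2 + 1 + 2 * sigma (-3) * p%:Z,
          (#|vieta_deficient C D|)%:Z = 3 * p%:Z - 11,
          (#|vieta_of_degree C D 2|)%:Z = 3 * (p%:Z - 4),
          #|vieta_of_degree C D 1| = 0%N
        & #|vieta_of_degree C D 0| = 1%N]
    & K <> 0 -> K <> -1 ->
      [/\ (#|vieta_vertices C D|)%:Z
            = p%:Z ^+ 2 + 1 + 3 * sigma (K ^+ 2 - 4) * p%:Z,
          (#|vieta_deficient C D|)%:Z = 3 * p%:Z - 14 - 3 * sigma (- K - 1),
          (#|vieta_of_degree C D 2|)%:Z = 3 * (p%:Z - 6 - sigma (- K - 1)),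
          #|vieta_of_degree C D 1| = 3%N
        & #|vieta_of_degree C D 0| = 1%N]].
Proof.
have two_neq0 : 2 != 0 :> 'F_p.
  rewrite -(dvdn_pcharf (pchar_Fp p_prime)); apply/negP => /(@dvdn_leq _ 2 isT).
  by rewrite leqNgt (leq_trans _ p_ge5).
move: K_neq2 K_neqN2 => /eqP Kneq2 /eqP KneqN2 C D sigma.
have cardV := card_vieta_vertices two_neq0 Kneq2 KneqN2.
have cardP := card_vieta_degree two_neq0 Kneq2 KneqN2.
have card_deficient := cardP (fun d => d < 3)%N isT.
have card_degree2 := cardP (fun d => d == 2%N) isT.
have card_degree1 := cardP (fun d => d == 1%N) isT.
have card_degree0 := cardP (fun d => d == 0%N) isT.
rewrite /= card_Fp // -/C -/D -/sigma in cardV card_deficient card_degree2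
  card_degree1 card_degree0.
split=> [K0|K1|/eqP/negbTE K0 /eqP/negbTE K1].
- have sK : sigma (K ^+ 2 - 4) = sigma (-1).
    (* For [K = 0] the argument is -4, which is -1 up to a square. *)
    transitivity (sigma (2 ^+ 2 * -1)); last exact: quadchar_sqrM.
    by congr sigma; rewrite K0; ring.
  have sK1 : sigma (- K - 1) = sigma (-1) by rewrite K0 oppr0 add0r.
  have eqK0 : (K == 0) = true by apply/eqP.
  rewrite sK sK1 eqK0 in cardV card_deficient card_degree2 card_degree1 card_degree0.
  split.
  + by rewrite cardV /=; ring.
  + by rewrite [LHS]card_deficient /=; ring.
  + by rewrite [LHS]card_degree2 /=; ring.
  + by apply/eqP; rewrite -eqz_nat; apply/eqP; rewrite [LHS]card_degree1 /=; ring.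
  + by apply/eqP; rewrite -eqz_nat; apply/eqP; rewrite [LHS]card_degree0 /=; ring.
- have sK : sigma (K ^+ 2 - 4) = sigma (-3) by congr sigma; rewrite K1; ring.
  have sK1 : sigma (- K - 1) = 0 by rewrite K1 opprK subrr; exact: quadchar0.
  have eqK0 : (K == 0) = false by rewrite K1 oppr_eq0 oner_eq0.
  have eqK1 : (K == -1) = true by apply/eqP.
  rewrite sK sK1 eqK0 eqK1 in cardV card_deficient card_degree2 card_degree1 card_degree0.
  split.
  + by rewrite cardV /=; ring.
  + by rewrite [LHS]card_deficient /=; ring.
  + by rewrite [LHS]card_degree2 /=; ring.
  + by apply/eqP; rewrite -eqz_nat; apply/eqP; rewrite [LHS]card_degree1 /=; ring.
  + by apply/eqP; rewrite -eqz_nat; apply/eqP; rewrite [LHS]card_degree0 /=; ring.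
- rewrite K0 K1 in cardV card_deficient card_degree2 card_degree1 card_degree0.
  split.
  + by rewrite cardV /=; ring.
  + by rewrite [LHS]card_deficient /=; ring.
  + by rewrite [LHS]card_degree2 /=; ring.
  + by apply/eqP; rewrite -eqz_nat; apply/eqP; rewrite [LHS]card_degree1 /=; ring.
  + by apply/eqP; rewrite -eqz_nat; apply/eqP; rewrite [LHS]card_degree0 /=; ring.
Qed.
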